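(* Let $A,B\in\mathbb{R}^{n\times n}$, $b\in\mathbb{R}^n$, and let $\Omega\in\mathbb{R}^{n\times n}$ be a positive semi-definite matrix such that $\Omega+A$ is nonsingular. If $$\|(\Omega+A)^{-1}\|_2<\frac{1}{\|\Omega-A\|_2+2\|B\|_2},$$ then, for any initial vector $x^{(0)}\in\mathbb{R}^n$, the iteration sequence $\{x^{(k)}\}_{k=0}^{+\infty}$ generated by the SSMN iteration $$(\Omega+A)x^{(k+1)}=(\Omega-A)x^{(k)}+2\big(B|x^{(k)}|+b\big),\quad k=0,1,2,\ldots,$$ converges to the solution $x^{*}$ of the generalized absolute value equation $Ax-B|x|=b$.
   Context: For $x=(x_1,\ldots,x_n)^T\in\mathbb{R}^n$, $|x|=(|x_1|,\ldots,|x_n|)^T$ is the componentwise absolute value. The generalized absolute value equation (GAVE) is $Ax-B|x|=b$ with given $A,B\in\mathbb{R}^{n\times n}$, $b\in\mathbb{R}^n$ and unknown $x\in\mathbb{R}^n$; $x^*$ denotes its solution. $\|\cdot\|_2$ is the Euclidean norm on vectors and the induced spectral norm on matrices. SSMN stands for shift splitting modified Newton-type; the iteration is the one displayed in the claim. *)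

(* Defs.v *)
From HB Require Import structures.
From mathcomp Require Import all_boot all_order all_algebra.
From mathcomp Require Import all_classical all_reals all_analysis.

Set Implicit Arguments.
Unset Strict Implicit.
Unset Printing Implicit Defensive.

Import Order.TTheory GRing.Theory Num.Theory.
Import numFieldNormedType.Exports.

Local Open Scope classical_set_scope.
Local Open Scope ring_scope.

(* `|x| on a matrix type is the max norm of MathComp-Analysis, hence the
   separate name for the componentwise absolute value. *)
Definition absmx (R : realType) (m n : nat) (x : 'M[R]_(m, n)) : 'M[R]_(m, n) :=
  map_mx (fun t : R => `|t|) x.

Definition l2norm (R : realType) (n : nat) (x : 'cV[R]_n) : R :=
  Num.sqrt (\sum_(i < n) x i ord0 ^+ 2).

(* The supremum is taken over the closed unit ball rather than the unit sphere
   so that the set of values is nonempty also for n = 0. *)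
Definition spectral_norm (R : realType) (m n : nat) (M : 'M[R]_(m, n)) : R :=
  sup [set l2norm (M *m x) | x in [set x : 'cV[R]_n | l2norm x <= 1]].

(* Symmetry is not required. *)
Definition pos_semidef (R : realType) (n : nat) (M : 'M[R]_n) : Prop :=
  forall x : 'cV[R]_n, 0 <= (x^T *m M *m x) ord0 ord0.

Definition gave_solution (R : realType) (n : nat) (A B : 'M[R]_n)
    (b x : 'cV[R]_n) : Prop :=
  A *m x - B *m absmx x = b.

Definition ssmn_iteration (R : realType) (n : nat) (A B Omega : 'M[R]_n)
    (b x0 : 'cV[R]_n) (x : nat -> 'cV[R]_n) : Prop :=
  x 0%N = x0 /\
  forall k : nat,
    (Omega + A) *m x k.+1 = (Omega - A) *m x k + 2 *: (B *m absmx (x k) + b).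

(* Main.v *)
From HB Require Import structures.
Require Import Defs.
From mathcomp Require Import all_boot all_order all_algebra.
From mathcomp Require Import all_classical all_reals all_analysis.
From mathcomp Require Import ring lra.
Import Order.TTheory GRing.Theory Num.Theory.
Import numFieldNormedType.Exports.
Local Open Scope classical_set_scope.
Local Open Scope ring_scope.

(** Multiplying the iteration by [(Omega + A)^-1] turns it into the Picard
    iteration [x_(k+1) = T x_k] of
      [T x = (Omega + A)^-1 ((Omega - A) x + 2 (B |x| + b))],
    and [T x = x] says [2 (A x) = 2 (B |x| + b)], so the fixed points of [T] are
    exactly the solutions of the equation ([ssmn_map_fixed]).

    Since [x |-> |x|] is nonexpansive for the Euclidean norm
    ([l2norm_absmxB]), [T] is Lipschitz for that norm with constant
      [q = ||(Omega + A)^-1|| (||Omega - A|| + 2 ||B||)]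
    ([ssmn_map_lipschitz]). The norm hypothesis gives [q < 1]; its
    right-hand side is positive, because it exceeds a norm, so the sum
    [||Omega - A|| + 2 ||B||] is positive and the inequality may be multiplied
    by it. Existence, uniqueness and convergence then follow from the
    contraction principle.

    For existence, Banach's fixed point theorem is applied in the maximum
    norm, for which the matrix space is a Banach space. The map [T] need not
    contract that norm, but [T^k] has Euclidean constant [q^k], and the two
    norms are equivalent, so [T^k] contracts the maximum norm once
    [q^k sqrt n < 1]. Its fixed point [p] is unique, and [T p] is also fixed by
    [T^k], hence [T p = p]
    ([l2_contraction_fixed_exists]). *)

(** * The Euclidean norm *)

Section EuclideanNorm.
Context {R : realType} {n : nat}.
Implicit Types x y : 'cV[R]_n.

Lemma sum_sqr_ge0 x : 0 <= \sum_(i < n) x i ord0 ^+ 2.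
Proof. by apply: sumr_ge0 => i _; exact: sqr_ge0. Qed.

Lemma l2norm_ge0 x : 0 <= l2norm x.
Proof. exact: sqrtr_ge0. Qed.

Lemma sqr_l2norm x : l2norm x ^+ 2 = \sum_(i < n) x i ord0 ^+ 2.
Proof. by rewrite sqr_sqrtr ?sum_sqr_ge0. Qed.

Lemma normr_coord_le_l2norm x i : `|x i ord0| <= l2norm x.
Proof.
rewrite -sqrtr_sqr ler_wsqrtr// (bigD1 i)//= lerDl.
by apply: sumr_ge0 => j _; exact: sqr_ge0.
Qed.

Lemma l2norm_eq0 x : l2norm x = 0 -> x = 0.
Proof.
move=> x0; apply/matrixP => i j; rewrite (ord1 j) mxE; apply/eqP.
by rewrite -normr_le0 -x0 normr_coord_le_l2norm.
Qed.

Lemma l2norm_mono x y :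
  (forall i, `|x i ord0| <= `|y i ord0|) -> l2norm x <= l2norm y.
Proof.
move=> xy; apply: ler_wsqrtr; apply: ler_sum => i _.
rewrite -real_normK ?num_real// -[leRHS]real_normK ?num_real//.
by rewrite ler_sqr ?nnegrE.
Qed.

Lemma l2normZ (c : R) x : l2norm (c *: x) = `|c| * l2norm x.
Proof.
rewrite /l2norm -sqrtr_sqr -sqrtrM ?sqr_ge0// mulr_sumr; congr Num.sqrt.
by apply: eq_bigr => i _; rewrite mxE exprMn.
Qed.

(** The Cauchy-Schwarz inequality, obtained from the arithmetic-geometric mean
    inequality on each coordinate after rescaling both vectors to a common
    norm. *)
Lemma dot_le_l2normM x y :
  \sum_(i < n) x i ord0 * y i ord0 <= l2norm x * l2norm y.
Proof.
have [/l2norm_eq0 ->|xn0] := eqVneq (l2norm x) 0.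
  rewrite big1 ?mulr_ge0 ?l2norm_ge0// => i _.
  by rewrite mxE mul0r.
have [/l2norm_eq0 ->|yn0] := eqVneq (l2norm y) 0.
  rewrite big1 ?mulr_ge0 ?l2norm_ge0// => i _.
  by rewrite mxE mulr0.
have x0 : 0 < l2norm x by rewrite lt_def xn0 l2norm_ge0.
have y0 : 0 < l2norm y by rewrite lt_def yn0 l2norm_ge0.
rewrite -(ler_pM2l (mulr_gt0 (ltr0n R 2) (mulr_gt0 x0 y0))).
(* Sum 2 (s x_i) (t y_i) <= (t x_i)^2 + (s y_i)^2, with s = |x| and t = |y|. *)
have -> : 2 * (l2norm x * l2norm y) * (l2norm x * l2norm y) =
    \sum_(i < n) (l2norm y ^+ 2 * x i ord0 ^+ 2 +
                  l2norm x ^+ 2 * y i ord0 ^+ 2).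
  by rewrite big_split /= -!mulr_sumr -!sqr_l2norm; ring.
rewrite mulr_sumr; apply: ler_sum => i _; rewrite -subr_ge0.
set a := l2norm x; set c := l2norm y.
have -> : c ^+ 2 * x i ord0 ^+ 2 + a ^+ 2 * y i ord0 ^+ 2 -
    2 * (a * c) * (x i ord0 * y i ord0) = (c * x i ord0 - a * y i ord0) ^+ 2.
  by ring.
exact: sqr_ge0.
Qed.

Lemma l2normD x y : l2norm (x + y) <= l2norm x + l2norm y.
Proof.
rewrite -ler_sqr ?nnegrE ?addr_ge0 ?l2norm_ge0//.
have -> : l2norm (x + y) ^+ 2 =
    l2norm x ^+ 2 + 2 * (\sum_(i < n) x i ord0 * y i ord0) + l2norm y ^+ 2.
  rewrite !sqr_l2norm mulr_sumr -!big_split /=; apply: eq_bigr => i _.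
  by rewrite mxE; ring.
by have := dot_le_l2normM x y; nra.
Qed.

(** Here and in the next lemma [`|x|] is the maximum norm, which defines the
    topology of the matrix space. *)
Lemma normr_le_l2norm x : `|x| <= l2norm x.
Proof.
have [->|x0] := eqVneq `|x| 0; first exact: l2norm_ge0.
have [[i j] /= xE] := mx_norm_neq0 x0.
by rewrite [leLHS]xE (ord1 j) normr_coord_le_l2norm.
Qed.

Lemma l2norm_le_normr x : l2norm x <= Num.sqrt n%:R * `|x|.
Proof.
rewrite -[`|x|]ger0_norm// -sqrtr_sqr -sqrtrM ?ler0n//; apply: ler_wsqrtr.
have -> : n%:R * `|x| ^+ 2 = \sum_(i < n) `|x| ^+ 2.
  by rewrite sumr_const card_ord mulr_natl.
apply: ler_sum => i _.
rewrite -real_normK ?num_real// ler_sqr ?nnegrE//.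
rewrite [leRHS]/Num.norm/= mx_normrE.
by apply: (le_bigmax _ (fun ij => `|x ij.1 ij.2|) (i, ord0)).
Qed.

Lemma l2norm_absmxB x y : l2norm (absmx x - absmx y) <= l2norm (x - y).
Proof. by apply: l2norm_mono => i; rewrite !mxE ler_dist_dist. Qed.

End EuclideanNorm.

(** * The spectral norm *)

Section SpectralNorm.
Context {R : realType} {m n : nat}.
Implicit Types (M : 'M[R]_(m, n)) (x : 'cV[R]_n).

(** Every value entering the supremum is bounded because vectors of the unit
    ball have coordinates in [[-1, 1]]. Without such a bound [sup] would
    carry no information. *)
Lemma spectral_norm_has_ubound M :
  has_ubound [set l2norm (M *m x) | x in [set x : 'cV[R]_n | l2norm x <= 1]].
Proof.
exists (l2norm (\col_i \sum_j `|M i j|)) => _ [x /= x1 <-].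
apply: l2norm_mono => i; rewrite !mxE.
rewrite [leRHS]ger0_norm ?sumr_ge0//.
apply: le_trans (ler_norm_sum _ _ _) _; apply: ler_sum => j _.
rewrite normrM ler_piMr//.
exact: le_trans (normr_coord_le_l2norm _ _) x1.
Qed.

Lemma spectral_norm_ge0 M : 0 <= spectral_norm M.
Proof.
apply: le_trans (l2norm_ge0 (M *m 0)) _.
apply: ub_le_sup; first exact: spectral_norm_has_ubound.
by exists 0 => //=; rewrite -(scale0r 0) l2normZ normr0 mul0r.
Qed.

Lemma l2norm_mulmx_le M x : l2norm (M *m x) <= spectral_norm M * l2norm x.
Proof.
have [/l2norm_eq0 ->|xn0] := eqVneq (l2norm x) 0.
  rewrite mulmx0 -(scale0r 0) l2normZ normr0 mul0r.
  by rewrite mulr_ge0 ?spectral_norm_ge0 ?l2norm_ge0.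
have x0 : 0 < l2norm x by rewrite lt_def xn0 l2norm_ge0.
rewrite -ler_pdivrMr//.
have -> : l2norm (M *m x) / l2norm x = l2norm (M *m ((l2norm x)^-1 *: x)).
  by rewrite -scalemxAr l2normZ gtr0_norm ?invr_gt0// mulrC.
apply: ub_le_sup; first exact: spectral_norm_has_ubound.
exists ((l2norm x)^-1 *: x) => //=.
by rewrite l2normZ gtr0_norm ?invr_gt0// mulVf.
Qed.

End SpectralNorm.

(** * Contractions for the Euclidean norm *)

Section EuclideanContraction.

(** Matrix spaces carry a complete uniform structure and a norm; this joins
    the two into a Banach space. *)
HB.instance Definition _ (R : realType) (m n : nat) :=
  Complete.on 'M[R]_(m, n).

Context {R : realType} {n : nat} {q : R} {T : 'cV[R]_n -> 'cV[R]_n}.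
Hypothesis q_ge0 : 0 <= q.
Hypothesis q_lt1 : q < 1.
Hypothesis T_lip : forall x y, l2norm (T x - T y) <= q * l2norm (x - y).

Lemma l2_lipschitz_iter k x y :
  l2norm (iter k T x - iter k T y) <= q ^+ k * l2norm (x - y).
Proof.
elim: k => [|k IH]; first by rewrite expr0 mul1r.
rewrite !iterS; apply: le_trans (T_lip _ _) _.
by rewrite exprS -mulrA ler_wpM2l.
Qed.

Lemma l2_contraction_fixed_unique x y : T x = x -> T y = y -> x = y.
Proof.
move=> Tx Ty; apply/subr0_eq/l2norm_eq0/eqP.
rewrite eq_le l2norm_ge0 andbT leNgt; apply/negP => d_gt0.
have := T_lip x y; rewrite Tx Ty leNgt => /negP; apply.
by rewrite gtr_pMl.
Qed.

Lemma cvg_expr_mulr (c : R) : (fun k => q ^+ k * c) @ \oo --> (0 : R).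
Proof.
rewrite -(mul0r c); apply: cvgMl; apply: cvg_expr.
by rewrite ger0_norm.
Qed.

(** A power of [T] contracts the maximum norm; [T] maps the fixed point of that
    power to a fixed point of the same power, and uniqueness gives [T p = p]. *)
Lemma l2_contraction_fixed_exists : exists p, T p = p.
Proof.
have [k kn] : exists k, q ^+ k * Num.sqrt n%:R < 1.
  have /cvgrPdist_lt/(_ 1 ltr01)[k _ /(_ k (leqnn k))] :=
    cvg_expr_mulr (Num.sqrt n%:R).
  rewrite /= sub0r normrN ger0_norm; first by exists k.
  by rewrite mulr_ge0 ?exprn_ge0 ?sqrtr_ge0.
have r_ge0 : 0 <= q ^+ k * Num.sqrt n%:R.
  by rewrite mulr_ge0 ?exprn_ge0 ?sqrtr_ge0.
have contr : is_contraction [fun of totalfun (iter k T)].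
  exists (NngNum r_ge0); split => //= -[x y] _ /=.
  apply: le_trans (normr_le_l2norm _) _.
  apply: le_trans (l2_lipschitz_iter _ _ _) _.
  by rewrite -mulrA ler_wpM2l ?exprn_ge0// l2norm_le_normr.
have [|p _ pE] := banach_fixed_point contr closedT; first by exists 0.
exists p; apply: (contraction_fixpoint_unique contr) => //.
by rewrite [RHS](esym (iterSr k T p)) iterS; congr T.
Qed.

Lemma l2_contraction_cvg p (x : nat -> 'cV[R]_n) :
  T p = p -> (forall k, x k.+1 = T (x k)) -> x @ \oo --> p.
Proof.
move=> Tp xS; apply/cvgrPdist_lt => e e0.
have /cvgrPdist_lt/(_ e e0) := cvg_expr_mulr (l2norm (p - x 0%N)).
apply: filterS => k; rewrite sub0r normrN => /(le_lt_trans (ler_norm _)).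
apply: le_lt_trans; apply: le_trans (normr_le_l2norm _) _.
have -> : x k = iter k T (x 0%N) by elim: k => //= k <-.
have {1}-> : p = iter k T p by elim: k => //= k <-.
exact: l2_lipschitz_iter.
Qed.

End EuclideanContraction.

(** * The iteration map *)

Section SSMNMap.
Context {R : realType} {n : nat} (A B Omega : 'M[R]_n) (b : 'cV[R]_n).
Hypothesis OmegaA_unit : Omega + A \in unitmx.

Definition ssmn_map (x : 'cV[R]_n) : 'cV[R]_n :=
  invmx (Omega + A) *m ((Omega - A) *m x + 2 *: (B *m absmx x + b)).

Lemma eq_ssmn_map x y :
  (Omega + A) *m y = (Omega - A) *m x + 2 *: (B *m absmx x + b) <->
  y = ssmn_map x.
Proof.
rewrite /ssmn_map; split => [<-|->]; first by rewrite mulKmx.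
by rewrite mulKVmx.
Qed.

(** With [x] on both sides, the iteration equation is
    [(Omega - A) x + 2 A x = (Omega - A) x + 2 (B |x| + b)], because
    [Omega + A = (Omega - A) + 2 A]. *)
Lemma ssmn_map_fixed x : ssmn_map x = x <-> gave_solution A B b x.
Proof.
transitivity ((Omega + A) *m x = (Omega - A) *m x + 2 *: (B *m absmx x + b)).
  by rewrite (eq_ssmn_map x x); split=> /esym.
have two0 : (2 : R) != 0 by rewrite pnatr_eq0.
have -> : (Omega + A) *m x = (Omega - A) *m x + 2 *: (A *m x).
  by rewrite mulmxDl mulmxBl scaler_nat mulr2n addrA subrK.
rewrite /gave_solution; split => [/addrI/(scalerI two0) ->|<-].
  by rewrite addrAC subrr add0r.
by rewrite addrCA subrr addr0.
Qed.

Lemma ssmn_map_lipschitz x y :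
  l2norm (ssmn_map x - ssmn_map y) <=
  spectral_norm (invmx (Omega + A)) *
    (spectral_norm (Omega - A) + 2 * spectral_norm B) * l2norm (x - y).
Proof.
have -> : ssmn_map x - ssmn_map y = invmx (Omega + A) *m
    ((Omega - A) *m (x - y) + 2 *: (B *m (absmx x - absmx y))).
  rewrite -mulmxBr; congr (_ *m _).
  rewrite !mulmxBr opprD addrACA -scalerBr.
  by rewrite (opprD (B *m absmx y) b) (addrACA (B *m absmx x)) subrr addr0.
apply: le_trans (l2norm_mulmx_le _ _) _.
rewrite -mulrA ler_wpM2l ?spectral_norm_ge0//.
apply: le_trans (l2normD _ _) _; rewrite mulrDl lerD ?l2norm_mulmx_le//.
rewrite l2normZ ger0_norm// -mulrA ler_wpM2l//.
apply: le_trans (l2norm_mulmx_le _ _) _.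
by rewrite ler_wpM2l ?spectral_norm_ge0// l2norm_absmxB.
Qed.

End SSMNMap.

Theorem theorem3p1 (R : realType) (n : nat) (A B Omega : 'M[R]_n)
    (b : 'cV[R]_n)
    (Omega_psd : pos_semidef Omega)
    (OmegaA_unit : Omega + A \in unitmx)
    (norm_lt : spectral_norm (invmx (Omega + A)) <
               1 / (spectral_norm (Omega - A) + 2 * spectral_norm B)) :
  exists xs : 'cV[R]_n,
    unique (gave_solution A B b) xs /\
    forall (x0 : 'cV[R]_n) (x : nat -> 'cV[R]_n),
      ssmn_iteration A B Omega b x0 x -> x @ \oo --> xs.
Proof.
set d := spectral_norm (Omega - A) + 2 * spectral_norm B in norm_lt.
set s := spectral_norm (invmx (Omega + A)) in norm_lt.
have s_ge0 : 0 <= s := spectral_norm_ge0 _.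
have d_gt0 : 0 < d.
  by have := le_lt_trans s_ge0 norm_lt; rewrite div1r invr_gt0.
have q_lt1 : s * d < 1 by rewrite -ltr_pdivlMr.
have q_ge0 : 0 <= s * d by rewrite mulr_ge0// ltW.
have lip := @ssmn_map_lipschitz R n A B Omega b.
have [p Tp] := l2_contraction_fixed_exists q_ge0 q_lt1 lip.
exists p; split.
  split=> [|y ysol]; first exact/(ssmn_map_fixed A B Omega b OmegaA_unit).
  apply: (l2_contraction_fixed_unique q_lt1 lip) => //.
  exact/(ssmn_map_fixed A B Omega b OmegaA_unit).
move=> x0 x [_ xS]; apply: (l2_contraction_cvg q_ge0 q_lt1 lip _ _ Tp) => k.
exact/(eq_ssmn_map A B Omega b OmegaA_unit).
Qed.
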